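(* Let $k\ge1$. Let $\mathcal S_k$ be the set of vectors $p=(p_\epsilon)_{\epsilon\in\{0,1\}^k}$ of nonnegative integers satisfying, for each $i=1,\dots,k$, the equation $\sum_{\epsilon\in\{0,1\}^k}(1-2\epsilon_i)\,p_\epsilon=0$ (equivalently, weights on the vertices of the unit $k$-cube such that every pair of opposite hyperfaces has equal total weight). Let $m_d(k)$ be the number of $p\in\mathcal S_k$ of total weight $\sum_\epsilon p_\epsilon=2d$, and set $G_k(q)=\sum_{d\ge0}m_d(k)q^{2d}$. Then $$G_k(q)=\sum_{d\ge0}q^{2d}\,\big\langle h_{d,d}\odot h_{d,d}\odot\cdots\odot h_{d,d},\, s_{2d}\big\rangle,$$ where in each term the Kronecker product has $k$ factors.
   Context: $h_{d,d}=h_dh_d$ is the complete homogeneous symmetric function indexed by the partition $(d,d)$; $s_{2d}$ is the Schur function indexed by $(2d)$; $\langle\cdot,\cdot\rangle$ is the Hall scalar product. For homogeneous symmetric functions $f,g$ of the same degree $n$, the Kronecker product is $f\odot g=\mathbf F\big((\mathbf F^{-1}f)\cdot(\mathbf F^{-1}g)\big)$, where $\mathbf F$ is the Frobenius characteristic map sending the irreducible character $\chi^\lambda$ of $S_n$ to $s_\lambda$ and the product of characters is pointwise. *)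

(* Defs.v *)
From mathcomp Require Import all_boot all_order all_algebra all_fingroup.
From mathcomp Require Import algC classfun.
From mathcomp Require Import mpoly.
From Stdlib Require Import ClassicalEpsilon.

Set Implicit Arguments.
Unset Strict Implicit.
Unset Printing Implicit Defensive.

Import Order.TTheory GRing.Theory Num.Theory.
Local Open Scope ring_scope.

(* The ring of symmetric functions is the graded inverse limit of the rings  *)
(* of symmetric polynomials in N variables, so a symmetric function is       *)
(* represented by the family of its images in N variables, for all N.        *)
Definition symfun := forall N : nat, {mpoly algC[N]}.

Definition complete (r : nat) : symfun :=
  fun N => \sum_(m : 'X_{1..N < r.+1} | mdeg m == r) 'X_[m].

Definition h_ (la : seq nat) : symfun :=
  fun N => \prod_(r <- la) complete r N.

Definition powersum (r : nat) : symfun :=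
  fun N => \sum_(i < N) 'X_i ^+ r.

(* Cells of the Young diagram of la: pairs (i, j) with j < la_i. *)
Definition cell (la : seq nat) := {i : 'I_(size la) & 'I_(nth 0%N la i)}.

Definition cell_row (la : seq nat) (c : cell la) : nat := tag c.
Definition cell_col (la : seq nat) (c : cell la) : nat := tagged c.

Definition semistandard (la : seq nat) (N : nat)
    (T : {ffun cell la -> 'I_N}) : bool :=
  [forall c, forall c',
     ((cell_row c == cell_row c') && (cell_col c <= cell_col c')%N
        ==> (T c <= T c')%N)
  && ((cell_col c == cell_col c') && (cell_row c < cell_row c')%N
        ==> (T c < T c')%N)].

Definition schur (la : seq nat) : symfun :=
  fun N => \sum_(T : {ffun cell la -> 'I_N} | semistandard T)
             \prod_(c : cell la) 'X_(T c).

(* Partitions of n, padded with zeros to n parts (h_0 = 1). *)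
Definition is_part (n : nat) (la : n.-tuple 'I_n.+1) : bool :=
  sorted geq (map val la) && (sumn (map val la) == n).

(* The coefficient of x^la in f, that is, the coordinate of f on the         *)
(* monomial symmetric function m_la; n variables suffice for la |- n.        *)
Definition mcoord (n : nat) (f : symfun) (la : n.-tuple 'I_n.+1) : algC :=
  (f n)@_[multinom (tnth la i : nat) | i < n].

(* The coordinates in the basis (h_la), la |- n, of g homogeneous of degree  *)
(* n; only the values at partitions are meaningful.                          *)
Definition hcoord (n : nat) (g : symfun) : {ffun n.-tuple 'I_n.+1 -> algC} :=
  epsilon (inhabits 0) (fun a : {ffun n.-tuple 'I_n.+1 -> algC} =>
    forall N, g N = \sum_(la | is_part la) a la *: h_ (map val la) N).

(* The Hall scalar product in degree n: <m_la, h_mu> = (la == mu), extended  *)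
(* bilinearly.                                                               *)
Definition hall (n : nat) (f g : symfun) : algC :=
  \sum_(la : n.-tuple 'I_n.+1 | is_part la) mcoord f la * hcoord n g la.

(* F(phi) = (1 / n!) \sum_(w in S_n) phi(w) p_(cycle type of w), the cycles  *)
(* of w, fixed points included, being the elements of porbits w.             *)
Definition Frobenius (n : nat) (phi : 'CF([set: 'S_n])) : symfun :=
  fun N => (n`!%:R)^-1 *:
    \sum_(w : 'S_n) phi w *: \prod_(c in porbits w) powersum #|c| N.

Definition Frobenius_inv (n : nat) (f : symfun) : 'CF([set: 'S_n]) :=
  epsilon (inhabits 0) (fun phi : 'CF([set: 'S_n]) =>
    forall N, Frobenius phi N = f N).

(* For f and g homogeneous of degree n; the product of class functions is    *)
(* pointwise.                                                                *)
Definition kronecker (n : nat) (f g : symfun) : symfun :=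
  Frobenius (Frobenius_inv n f * Frobenius_inv n g).

(* f (.) f (.) ... (.) f with k factors; iterop only returns its last        *)
(* argument when k = 0.                                                      *)
Definition kronecker_pow (n k : nat) (f : symfun) : symfun :=
  iterop k (kronecker n) f (fun=> 0).

(* Vertices of the unit k-cube. *)
Definition cube (k : nat) := {ffun 'I_k -> bool}.

Definition in_S (k : nat) (p : {ffun cube k -> nat}) : bool :=
  [forall i : 'I_k, \sum_(e : cube k) (1 - 2 * (e i : nat)%:Z) * (p e)%:Z == 0].

Definition weight (k : nat) (p : {ffun cube k -> nat}) : nat :=
  (\sum_(e : cube k) p e)%N.

(* Entries of a vector of total weight 2d are at most 2d (see solutionsP);   *)
(* bounding them makes the set of solutions a finite set.                    *)
Definition unbound (k b : nat) (p : {ffun cube k -> 'I_b}) :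
  {ffun cube k -> nat} := [ffun e => val (p e)].

Definition solutions (d k : nat) : {set {ffun cube k -> 'I_(2 * d).+1}} :=
  [set p | in_S (unbound p) && (weight (unbound p) == (2 * d)%N)].

Definition m_ (d k : nat) : nat := #|solutions d k|.

Lemma unbound_inj (k b : nat) : injective (@unbound k b).
Proof.
by move=> p q /ffunP e; apply/ffunP => x; apply/val_inj; move: (e x); rewrite !ffunE.
Qed.

Lemma solutionsP (d k : nat) (p : {ffun cube k -> nat}) :
  reflect (exists2 q, q \in solutions d k & p = unbound q)
          (in_S p && (weight p == (2 * d)%N)).
Proof.
apply: (iffP idP) => [pS | [q]]; last by rewrite inE => qS ->.
have le_p e : (p e < (2 * d).+1)%N.
  by case/andP: pS => _ /eqP <-; rewrite ltnS /weight (bigD1 e) //= leq_addr.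
have def_p : p = unbound [ffun e => Ordinal (le_p e)].
  by apply/ffunP => e; rewrite !ffunE.
by exists [ffun e => Ordinal (le_p e)]; rewrite // inE -def_p.
Qed.

(* The formal power series \sum_d c_d q^(2d), as its coefficient sequence. *)
Definition series_q2 (c : nat -> algC) : nat -> algC :=
  fun n => if odd n then 0 else c n./2.

Definition G (k : nat) : nat -> algC := series_q2 (fun d => (m_ d k)%:R).

(* Main.v *)
(* The symmetric group S_n acts on the words of length n in a finite alphabet C
   by permuting positions, and two words are in the same orbit iff they have the
   same content (letter multiplicities), so counting the words fixed by each
   permutation counts contents, by Burnside's lemma.
   Expanding a product of power sums over the cycles of w as a sum over the
   w-fixed words in N letters, one gets that F maps the permutation character on
   words of content a to the product of the h_(a_c). In particular h_(d,d) comes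
   from the words in two letters, each used d times, and the k-th power of that
   character counts fixed words in the alphabet {0,1}^k with balanced
   coordinates. Pairing with s_(2d) averages the character over S_(2d), i.e.,
   counts the orbits of these words: their contents are the vectors of S_k of
   total weight 2d. *)

Require Import Defs.
From mathcomp Require Import all_boot all_order all_algebra all_fingroup.
From mathcomp Require Import algC classfun.
From mathcomp Require Import mpoly.
From Stdlib Require Import ClassicalEpsilon FunctionalExtensionality.

Set Implicit Arguments.
Unset Strict Implicit.
Unset Printing Implicit Defensive.

Import Order.TTheory GRing.Theory Num.Theory.
Local Open Scope ring_scope.

(** * Words, their contents, and Burnside counting *)

Definition fixed_word (n : nat) (C : finType) (w : 'S_n)
    (u : {ffun 'I_n -> C}) : bool := [forall i, u (w i) == u i].

(** A letter occurs at most [n] times, so [inord] never truncates; the bound makes contents a finite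
    type to sum over. *)
Definition content (n : nat) (C : finType) (u : {ffun 'I_n -> C}) :
    {ffun C -> 'I_n.+1} := [ffun c => inord #|[set i | u i == c]|].

Definition precomp (n : nat) (C : finType) (u : {ffun 'I_n -> C}) (g : 'S_n) :
    {ffun 'I_n -> C} := [ffun i => u (g i)].

Section Words.
Variables (n : nat) (C : finType).
Implicit Types (u v : {ffun 'I_n -> C}) (w g : 'S_n) (c : {ffun C -> 'I_n.+1}).

Lemma fixed_wordP w u : reflect (forall i, u (w i) = u i) (fixed_word w u).
Proof. by apply: (iffP forallP) => uw i; apply/eqP; rewrite uw. Qed.

Lemma contentE u x : content u x = #|[set i | u i == x]| :> nat.
Proof. by rewrite ffunE inordK // ltnS (leq_trans (max_card _)) ?card_ord. Qed.

Lemma count_codom u x : count_mem x [tuple u i | i < n] = content u x.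
Proof.
rewrite contentE count_map /= cardE enumT /enum_mem size_filter.
by apply: eq_count => i; rewrite /= inE.
Qed.

Lemma sum_content u (P : pred C) :
  (\sum_(x | P x) content u x)%N = #|[set i | P (u i)]|.
Proof.
rewrite -sum1_card (partition_big u P) => [|i]; last by rewrite inE.
apply: eq_bigr => x Px; rewrite contentE -sum1_card; apply: eq_bigl => i.
by rewrite !inE; case: eqP => [->|]; rewrite ?Px ?andbF.
Qed.

Lemma content_precomp u g : content (precomp u g) = content u.
Proof.
apply/ffunP=> x; apply/val_inj; rewrite /= !contentE -[RHS](card_preimset _ (@perm_inj _ g)).
by apply: eq_card => i; rewrite !inE ffunE.
Qed.

(** Contents thus index the orbits of [S_n] on words, as Burnside counting requires. *)
Lemma content_eqP u v :
  reflect (exists g, v = precomp u g) (content v == content u).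
Proof.
apply: (iffP eqP) => [eq_uv | [g ->]]; last exact: content_precomp.
have /tuple_permP[g eq_g] : perm_eq [tuple v i | i < n] [tuple u i | i < n].
  by apply/allP => x _ /=; rewrite !count_codom eq_uv.
exists g; apply/ffunP => i; rewrite ffunE.
have /(congr1 (fun t => tnth t i)) := val_inj eq_g.
by rewrite !tnth_mktuple.
Qed.

Lemma content_onto c : (\sum_x c x)%N = n -> exists u, content u = c.
Proof.
move=> sum_c; pose s := flatten [seq nseq (c x) x | x <- enum C].
have size_s : size s == n.
  rewrite size_flatten /shape -map_comp sumnE big_map big_enum /=.
  by apply/eqP; rewrite -[RHS]sum_c; apply: eq_bigr => x _; rewrite size_nseq.
exists [ffun i => tnth (Tuple size_s) i]; apply/ffunP => x; apply/val_inj.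
rewrite /= -count_codom.
rewrite (_ : [tuple _ | i < n] = Tuple size_s); last first.
  by apply: eq_from_tnth => i; rewrite tnth_mktuple ffunE.
rewrite /= count_flatten -map_comp sumnE big_map big_enum /= (bigD1 x) //=.
rewrite count_nseq /= eqxx mul1n big1 ?addn0 // => y /negbTE.
by rewrite count_nseq /= => ->.
Qed.

(** Weighted Burnside lemma: each content class is one orbit, and the pairs of a word in it and a
    permutation fixing that word number [n!]. *)
Lemma sum_fixed_words (V : zmodType) (W : {ffun C -> 'I_n.+1} -> V) :
  \sum_(w : 'S_n) \sum_(u | fixed_word w u) W (content u) =
    (\sum_(c : {ffun C -> 'I_n.+1} | (\sum_x c x)%N == n) W c) *+ n`!.
Proof.
rewrite (exchange_big_dep xpredT) //= -sumrMnl.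
rewrite (partition_big (@content n C)
  (fun c : {ffun C -> 'I_n.+1} => (\sum_x c x)%N == n)); last first.
  by move=> u _; rewrite sum_content cardsE card_ord.
apply: eq_bigr => c /eqP/content_onto[u0 def_c].
(* Each [w] carries the base word [u0] to exactly one word, so [n!] pairs arise. *)
transitivity (\sum_u \sum_(w | precomp u0 w == u) W c); last first.
  rewrite (exchange_big_dep xpredT) //= (eq_bigr (fun=> W c)) => [|w _].
    by rewrite sumr_const card_Sn.
  by rewrite (big_pred1 (precomp u0 w)) // => u; rewrite eq_sym.
rewrite [RHS](bigID (fun u => content u == c)) /= [X in _ + X]big1 ?addr0; last first.
  move=> u ne_c; rewrite big1 // => w /eqP def_u; case/eqP: ne_c.
  by rewrite -def_u content_precomp.
apply: eq_bigr => u; rewrite -def_c => eq_c; case/content_eqP: (eq_c) => g def_u.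
(* As [u] is [precomp u0 g], right translation by [g] sends the stabilizer of [u] onto the
   permutations carrying [u0] to [u]. *)
rewrite (eqP eq_c) [RHS](reindex_inj (mulIg g)) /=; apply: eq_bigl => w.
apply/fixed_wordP/eqP => [fix_u | /ffunP eq_u i].
  by apply/ffunP => i; rewrite ffunE permM -fix_u def_u ffunE.
by have:= eq_u i; rewrite def_u !ffunE permM.
Qed.

End Words.

(** * Conjugacy of permutations with equal orbits *)

Section Conjugacy.
Variable T : finType.
Implicit Types (a b w : {perm T}) (x y : T).

Lemma expg_perm_eq w x i j :
  ((w ^+ i)%g x == (w ^+ j)%g x) = (i == j %[mod #|porbit w x|]).
Proof.
have m_gt0 : (0 < #|porbit w x|)%N by apply/card_gt0P; exists x; apply: porbit_id.
have redn k : (w ^+ k)%g x = nth x (traject w x #|porbit w x|) (k %% #|porbit w x|).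
  have period q : iter (q * #|porbit w x|)%N w x = x.
    by elim: q => // q IHq; rewrite mulSn iterD IHq iter_porbit.
  rewrite nth_traject ?ltn_mod // permX {1}(divn_eq k #|porbit w x|) addnC iterD.
  by rewrite period.
by rewrite !redn nth_uniq ?size_traject ?ltn_mod // uniq_traject_porbit.
Qed.

(** [pick] depends only on the orbit as a set, so its elements share one representative; the default
    is never reached, since the orbit contains [x]. *)
Definition porbit_repr w x := odflt x [pick y in porbit w x].

Lemma porbit_repr_in w x : porbit_repr w x \in porbit w x.
Proof. by rewrite /porbit_repr; case: pickP => //= _; apply: porbit_id. Qed.

Lemma porbit_repr_eq w x y :
  (porbit_repr w x == porbit_repr w y) = (porbit w x == porbit w y).
Proof.
apply/eqP/eqP => [eq_r | eq_o].
  have:= porbit_repr_in w x; rewrite eq_r -eq_porbit_mem => /eqP <-.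
  by apply/eqP; rewrite eq_porbit_mem porbit_repr_in.
rewrite /porbit_repr eq_o; case: pickP => //= /(_ y).
by rewrite porbit_id.
Qed.

(* Both permutations act simply transitively (as cyclic groups of the same
   order) on each common orbit, so [(a ^+ k) r |-> (b ^+ k) r], where r is the
   representative of the orbit, is well defined and conjugates a to b. *)
Lemma porbit_conjg a b : porbit a =1 porbit b -> exists g, b = (a ^ g)%g.
Proof.
move=> eq_ab; pose r := porbit_repr a.
have exk x : exists k, x == (a ^+ k)%g (r x).
  have: x \in porbit a (r x) by rewrite porbit_sym porbit_repr_in.
  by case/porbitP => k def_x; exists k; apply/eqP.
pose k x := xchoose (exk x); have kP x : (a ^+ k x)%g (r x) = x.
  by rewrite -(eqP (xchooseP (exk x))).
pose f x := (b ^+ k x)%g (r x).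
have f_eq x y i j : r x = r y ->
    ((a ^+ i)%g (r x) == (a ^+ j)%g (r y)) = ((b ^+ i)%g (r x) == (b ^+ j)%g (r y)).
  by move=> <-; rewrite !expg_perm_eq eq_ab.
have f_orb x : f x \in porbit a x.
  have /eqP <- : porbit a (r x) == porbit a x by rewrite eq_porbit_mem porbit_repr_in.
  by rewrite eq_ab mem_porbit.
have f_inj : injective f.
  move=> x y eq_f; have eq_r : r x = r y.
    apply/eqP; rewrite porbit_repr_eq; have:= f_orb x.
    rewrite eq_f -eq_porbit_mem => /eqP <-.
    by rewrite eq_porbit_mem f_orb.
  by apply/eqP; rewrite -[x]kP -[y]kP f_eq //; apply/eqP.
exists (perm f_inj); apply/permP => z.
have [x ->] : exists x, z = perm f_inj x.
  by exists ((perm f_inj)^-1%g z); rewrite permKV.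
rewrite permJ !permE.
have eq_r : r (a x) = r x.
  by apply/eqP; rewrite porbit_repr_eq eq_porbit_mem (mem_porbit a 1).
apply/esym/eqP; rewrite {1}/f; have -> : b (f x) = (b ^+ (k x).+1)%g (r x).
  by rewrite expgSr permM.
by rewrite -f_eq // kP expgSr permM kP.
Qed.

(** [g] factors through [f] by a map [h] of [f @: T] onto [g @: T], which the cardinality bound
    makes injective. It serves to identify a partition into orbits with a refinement having no more
    blocks. *)
Lemma eq_card_imset_inj (S1 S2 : finType) (f : T -> S1) (g : T -> S2) :
  (forall x y, f x = f y -> g x = g y) ->
  (#|f @: T| <= #|g @: T|)%N -> forall x y, g x = g y -> f x = f y.
Proof.
move=> fg le_fg x y; pose h s := if [pick z | f z == s] is Some z then g z else g x.
have hf z : h (f z) = g z.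
  rewrite /h; case: pickP => [z' /eqP/fg // | /(_ z)].
  by rewrite eqxx.
have def_g : g @: T = h @: (f @: T).
  by rewrite -imset_comp; apply: eq_imset => z /=; rewrite hf.
have /imset_injP h_inj : #|h @: (f @: T)| == #|f @: T|.
  by rewrite eqn_leq leq_imset_card -def_g.
move=> eq_g; apply: h_inj; rewrite ?imset_f //.
by rewrite !hf.
Qed.

End Conjugacy.

(** * Monomial expansion and injectivity of F *)

(** Expanding the product chooses one variable per cycle, which is the same as a word constant on
    cycles. *)
Lemma prod_powersum (n N : nat) (w : 'S_n) :
  \prod_(c in porbits w) powersum #|c| N =
    \sum_(t : {ffun 'I_n -> 'I_N} | fixed_word w t) \prod_i 'X_(t i).
Proof.
rewrite big_enum_val bigA_distr_bigA /=.
have mem_w i : porbit w i \in porbits w by apply: imset_f.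
pose idx i := enum_rank_in (mem_w i) (porbit w i).
have idxK i : enum_val (idx i) = porbit w i by rewrite enum_rankK_in.
have idx_eq i j : (idx i == j) = (i \in enum_val j).
  have /imsetP[x _ def_j] := enum_valP j.
  by rewrite -(inj_eq enum_val_inj) idxK def_j eq_porbit_mem.
have exrep (j : 'I_#|porbits w|) : exists i, i \in enum_val j.
  by have /imsetP[x _ ->] := enum_valP j; exists x; apply: porbit_id.
pose rep j := xchoose (exrep j).
have repK j : idx (rep j) = j by apply/eqP; rewrite idx_eq (xchooseP (exrep j)).
pose spread (f : {ffun 'I_#|porbits w| -> 'I_N}) := [ffun i => f (idx i)].
rewrite [RHS](reindex spread) /=; last first.
  exists (fun t : {ffun 'I_n -> 'I_N} => [ffun j => t (rep j)]) => [f _ | t].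
    by apply/ffunP => j; rewrite !ffunE repK.
  rewrite inE => /fixed_wordP fix_t; apply/ffunP => i; rewrite !ffunE.
  have: rep (idx i) \in porbit w i by rewrite -(idxK i) -idx_eq repK.
  case/porbitP => k ->; elim: k => [|k IHk]; first by rewrite perm1.
  by rewrite expgSr permM fix_t.
rewrite [RHS](eq_bigl xpredT) => [|f]; last first.
  apply/fixed_wordP => i; rewrite !ffunE; congr (f _); apply/eqP.
  by rewrite idx_eq idxK; apply: (mem_porbit w 1 i).
apply: eq_bigr => f _; rewrite [RHS](partition_big idx xpredT) //=.
apply: eq_bigr => j _; rewrite (eq_bigr (fun=> 'X_(f j))) => [|i /eqP <-].
  by rewrite prodr_const; congr (_ ^+ _); apply: eq_card => i; rewrite [RHS]idx_eq.
by rewrite ffunE.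
Qed.

Lemma prod_word (n N : nat) (t : {ffun 'I_n -> 'I_N}) :
  \prod_i 'X_(t i) = 'X_[[multinom (content t j : nat) | j < N]] :> {mpoly algC[N]}.
Proof.
rewrite (mpolyXE _ 1%g) (partition_big t xpredT) //=; apply: eq_bigr => j _.
rewrite perm1 mnmE contentE (eq_bigr (fun=> 'X_j)) => [|i /eqP -> //].
by rewrite prodr_const; congr (_ ^+ _); apply: eq_card => i; rewrite inE.
Qed.

Lemma mcoeff_Frobenius (n N : nat) (phi : 'CF([set: 'S_n])) (m : 'X_{1..N}) :
  (Frobenius phi N)@_m = (n`!%:R)^-1 * \sum_(w : 'S_n) phi w *
    #|[set t : {ffun 'I_n -> 'I_N} | fixed_word w t &
       [multinom (content t j : nat) | j < N] == m]|%:R.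
Proof.
rewrite mcoeffZ raddf_sum /=; congr (_ * _); apply: eq_bigr => w _.
rewrite mcoeffZ prod_powersum raddf_sum /=; congr (_ * _).
rewrite cardsE -sum1_card natr_sum big_mkcondr /=; apply: eq_bigr => t _.
by rewrite prod_word mcoeffX; case: eqP.
Qed.

(* Take w0 with the largest number of cycles among the w where phi and psi
   differ, and the coefficient of the monomial whose word t0 labels each position
   by its w0-cycle: a w contributing to it has, up to conjugacy, cycles refining
   those of w0, hence the same cycles by maximality. *)
Lemma Frobenius_inj (n : nat) (phi psi : 'CF([set: 'S_n])) :
  (forall N, Frobenius phi N = Frobenius psi N) -> phi = psi.
Proof.
move=> eq_F; apply/eqP; rewrite -subr_eq0; set chi := phi - psi.
apply/eqP/cfunP => w1; rewrite [RHS]cfunE; apply/eqP/negPn/negP => nz_w1.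
case: (@arg_maxnP _ w1 (fun w => chi w != 0) (fun w => #|porbits w|)) => //= w0 nz_w0 max_w0.
(* The letters of [t0] are themselves positions, so comparing images in [n] variables suffices. *)
pose t0 := [ffun i => porbit_repr w0 i].
have t0_eq i j : (t0 i == t0 j) = (porbit w0 i == porbit w0 j).
  by rewrite !ffunE porbit_repr_eq.
pose m0 := [multinom (content t0 j : nat) | j < n].
pose cnt w := #|[set t : {ffun 'I_n -> 'I_n} | fixed_word w t &
                   [multinom (content t j : nat) | j < n] == m0]|.
have sum0 : \sum_(w : 'S_n) chi w * (cnt w)%:R = 0.
  have := eq_F n => /(congr1 (fun p : {mpoly algC[n]} => n`!%:R * p@_m0)) /eqP.
  rewrite !mcoeff_Frobenius !mulrA !divff ?pnatr_eq0 -?lt0n ?fact_gt0 // !mul1r.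
  rewrite -subr_eq0 -sumrB => /eqP sum_eq; rewrite -[RHS]sum_eq.
  by apply: eq_bigr => w _; rewrite -mulrBl !cfunE.
(* All [w] in the support with a nonzero count have the value [chi w0], which factors out; the
   remaining factor is positive because [w0] fixes [t0], a contradiction. *)
have: chi w0 * (\sum_(w | chi w != 0%R) cnt w)%:R = 0.
  rewrite -[RHS]sum0 natr_sum mulr_sumr big_mkcond; apply: eq_bigr => w _.
  case: eqP => [-> | /eqP nz_w] /=; first by rewrite mul0r.
  have [-> | ] := posnP (cnt w); first by rewrite !mulr0.
  case/card_gt0P => t; rewrite inE => /andP[/fixed_wordP fix_t eq_t].
  congr (_ * _); have /content_eqP[g def_t] : content t == content t0.
    apply/eqP/ffunP => j; apply/val_inj.
    by have /eqP/mnmP/(_ j) := eq_t; rewrite !mnmE.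
  have fix_t0 i : t0 ((w ^ g)%g i) = t0 i.
    have [j ->] : exists j, i = g j by exists (g^-1%g i); rewrite permKV.
    by have := fix_t j; rewrite permJ def_t !ffunE.
  have refine i j : porbit (w ^ g)%g i = porbit (w ^ g)%g j -> porbit w0 i = porbit w0 j.
    move/eqP; rewrite eq_porbit_mem => /porbitP[k ->]; apply/eqP; rewrite -t0_eq.
    elim: k => [|k IHk]; first by rewrite perm1.
    by rewrite expgSr permM fix_t0.
  have nz_wg : chi (w ^ g)%g != 0 by rewrite cfunJ ?inE.
  have coarse i j : porbit w0 i = porbit w0 j -> porbit (w ^ g)%g i = porbit (w ^ g)%g j.
    exact: (eq_card_imset_inj refine (max_w0 _ nz_wg)).
  have [i|g' def_g'] := @porbit_conjg _ w0 (w ^ g)%g.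
    apply/setP => j; rewrite ![j \in _]porbit_sym -!eq_porbit_mem.
    by apply/eqP/eqP => [/coarse | /refine].
  by rewrite -[LHS](@cfunJ _ _ chi w0 g') ?inE // -def_g' cfunJ ?inE.
move/eqP; rewrite mulf_eq0 (negbTE nz_w0) pnatr_eq0 /= -leqn0 leqNgt.
rewrite (bigD1 w0) //= addn_gt0; case/negP; apply/orP; left.
apply/card_gt0P; exists t0; rewrite inE eqxx andbT; apply/fixed_wordP => i.
by apply/eqP; rewrite t0_eq eq_porbit_mem; apply: (mem_porbit w0 1 i).
Qed.

(** * Word characters and products of complete functions *)

(** Exponents are bounded by a common [n] instead of [r], so that factors of different degrees range
    over one finite type and their product can be distributed. *)
Lemma complete_ffun (n N r : nat) : (r <= n)%N ->
  complete r N = \sum_(f : {ffun 'I_N -> 'I_n.+1} | (\sum_j f j)%N == r)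
                   'X_[[multinom (f j : nat) | j < N]].
Proof.
move=> le_rn; rewrite /complete.
pose to_ffun (m : 'X_{1..N < r.+1}) : {ffun 'I_N -> 'I_n.+1} := [ffun j => inord (m j)].
(* The default [bm0] is reached only when the exponents add up to more than [r], outside the range
   of summation. *)
pose of_ffun (f : {ffun 'I_N -> 'I_n.+1}) : 'X_{1..N < r.+1} :=
  insubd bm0 [multinom (f j : nat) | j < N].
have to_ffunE m j : to_ffun m j = m j :> nat.
  rewrite ffunE inordK // ltnS (leq_trans _ le_rn) // -ltnS (leq_trans _ (bmdeg m)) //.
  by rewrite ltnS mdegE (bigD1 j) //= leq_addr.
have of_ffunE (f : {ffun 'I_N -> 'I_n.+1}) : (\sum_j f j)%N == r ->
    of_ffun f = [multinom (f j : nat) | j < N] :> 'X_{1..N}.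
  move=> /eqP sum_f; rewrite val_insubd mdegE; under eq_bigr do rewrite mnmE.
  by rewrite sum_f ltnSn.
rewrite (reindex_onto of_ffun to_ffun) /=; last first.
  move=> m _; apply/val_inj; rewrite /= val_insubd.
  have -> : [multinom (to_ffun m j : nat) | j < N] = m.
    by apply/mnmP => j; rewrite mnmE to_ffunE.
  by rewrite bmdeg.
apply: eq_big => [f | f /andP[deg_f /eqP to_f]]; last first.
  by congr 'X_[_]; apply/mnmP => j; rewrite mnmE -{2}to_f to_ffunE.
apply/andP/idP => [[/eqP deg_f /eqP to_f] | sum_f].
  by rewrite -deg_f mdegE; apply/eqP/eq_bigr => j _; rewrite -{1}to_f to_ffunE.
split; first by rewrite of_ffunE // mdegE (eq_bigr _ (fun j _ => mnmE _ j)).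
apply/eqP/ffunP => j; apply/val_inj.
by rewrite /= to_ffunE of_ffunE // mnmE.
Qed.

(** [precomp _ g] maps the words fixed by [w ^ g] bijectively to those fixed by [w], preserving
    contents. *)
Lemma wordchar_subproof (n : nat) (C : finType) (a : {ffun C -> 'I_n.+1}) :
  is_class_fun <<[set: 'S_n]>>%g [ffun w : 'S_n =>
    #|[set u : {ffun 'I_n -> C} | fixed_word w u & content u == a]|%:R].
Proof.
apply: intro_class_fun => [w g _ _ | w]; last by rewrite mem_gen ?inE.
congr (_%:R); have inj_g : injective (fun u : {ffun 'I_n -> C} => precomp u g).
  move=> u v /ffunP eq_uv; apply/ffunP => i.
  by have:= eq_uv (g^-1%g i); rewrite !ffunE permKV.
rewrite -[RHS](card_preimset _ inj_g); apply: eq_card => u.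
rewrite !inE content_precomp; congr (_ && _).
apply/fixed_wordP/fixed_wordP => fix_u i.
  by rewrite !ffunE -permJ fix_u.
by rewrite -[i](permKV g) permJ; have := fix_u (g^-1%g i); rewrite !ffunE.
Qed.

(* The permutation character of S_n on words of content a. *)
Definition wordchar (n : nat) (C : finType) (a : {ffun C -> 'I_n.+1}) :
  'CF([set: 'S_n]) := Cfun 0 (wordchar_subproof a).

Lemma wordcharE (n : nat) (C : finType) (a : {ffun C -> 'I_n.+1}) (w : 'S_n) :
  wordchar a w = \sum_(u : {ffun 'I_n -> C} | fixed_word w u && (content u == a)) 1.
Proof. by rewrite cfunE cardsE -sum1_card natr_sum. Qed.

Lemma content_map (n : nat) (C D : finType) (f : C -> D) (u : {ffun 'I_n -> C}) y :
  content [ffun i => f (u i)] y = (\sum_(x | f x == y) content u x)%N :> nat.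
Proof. by rewrite sum_content contentE; apply: eq_card => i; rewrite !inE ffunE. Qed.

Lemma sum_fst (A B : finType) (F : A * B -> nat) x :
  (\sum_(p | p.1 == x) F p = \sum_y F (x, y))%N.
Proof.
rewrite (reindex_onto (pair x) snd) /= => [|[x' y] /eqP /= -> //].
by apply: eq_bigl => y; rewrite !eqxx.
Qed.

Lemma sum_snd (A B : finType) (F : A * B -> nat) y :
  (\sum_(p | p.2 == y) F p = \sum_x F (x, y))%N.
Proof.
rewrite (reindex_onto (fun x => (x, y)) fst) /= => [|[x y'] /eqP /= -> //].
by apply: eq_bigl => x; rewrite !eqxx.
Qed.

(* Both sides count matrices with row sums a, weighted by the monomial of their
   column sums: these are the contents of words in the alphabet C * 'I_N. *)
Lemma Frobenius_wordchar (n N : nat) (C : finType) (a : {ffun C -> 'I_n.+1}) :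
  (\sum_x a x)%N = n -> Frobenius (wordchar a) N = \prod_x complete (a x) N.
Proof.
move=> sum_a; pose rows_a (c : {ffun C * 'I_N -> 'I_n.+1}) :=
  [forall x, (\sum_(p | p.1 == x) c p)%N == a x].
pose W (c : {ffun C * 'I_N -> 'I_n.+1}) : {mpoly algC[N]} :=
  if rows_a c then 'X_[[multinom (\sum_(p | p.2 == j) c p)%N | j < N]] else 0.
(* Two [w]-fixed words, over [C] and over ['I_N], amount to one [w]-fixed word over pairs of
   letters. *)
have term_w w : wordchar a w *: \prod_(c in porbits w) powersum #|c| N =
    \sum_(u : {ffun 'I_n -> C * 'I_N} | fixed_word w u) W (content u).
  rewrite prod_powersum wordcharE scaler_suml.
  under eq_bigr do rewrite scale1r.
  rewrite pair_big /=.
  pose unzip (u : {ffun 'I_n -> C * 'I_N}) : {ffun 'I_n -> C} * {ffun 'I_n -> 'I_N} :=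
    ([ffun i => (u i).1], [ffun i => (u i).2]).
  rewrite (reindex unzip) /=; last first.
    exists (fun st : {ffun 'I_n -> C} * {ffun 'I_n -> 'I_N} =>
              [ffun i => (st.1 i, st.2 i)]) => [u | [s t]] _.
      by apply/ffunP => i; rewrite !ffunE -surjective_pairing.
    by rewrite /unzip /=; congr pair; apply/ffunP => i; rewrite !ffunE.
  rewrite (eq_bigl (fun u => fixed_word w u && rows_a (content u))) => [|u].
    rewrite big_mkcondr /=; apply: eq_bigr => u _; rewrite /W; case: ifP => // _.
    rewrite prod_word; congr 'X_[_]; apply/mnmP => j; rewrite !mnmE.
    exact: content_map.
  rewrite andbAC; congr (_ && _).
    apply/andP/fixed_wordP => [[/fixed_wordP fix1 /fixed_wordP fix2] i | fix_u].
      have := fix1 i; have := fix2 i; rewrite !ffunE.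
      by case: (u _) (u _) => [x y] [x' y'] /= -> ->.
    by split; apply/fixed_wordP => i; rewrite !ffunE fix_u.
  apply/eqP/forallP => [<- x | eq_a].
    by apply/eqP/esym/content_map.
  apply/ffunP => x; apply/val_inj; rewrite -[RHS](eqP (eq_a x)).
  exact: content_map.
rewrite /Frobenius (eq_bigr _ (fun w _ => term_w w)) sum_fixed_words.
rewrite -scaler_nat scalerA mulVf ?scale1r; last by rewrite pnatr_eq0 -lt0n fact_gt0.
have le_an x : (a x <= n)%N by rewrite -ltnS.
rewrite [RHS](eq_bigr _ (fun x _ => complete_ffun N (le_an x))) bigA_distr_big_dep /=.
(* Row [x] of the matrix is the exponent vector chosen in the factor of index [x]. *)
pose curryc (c : {ffun C * 'I_N -> 'I_n.+1}) : {ffun C -> {ffun 'I_N -> 'I_n.+1}} :=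
  [ffun x => [ffun j => c (x, j)]].
rewrite [RHS](reindex curryc) /=; last first.
  exists (fun F : {ffun C -> {ffun 'I_N -> 'I_n.+1}} => [ffun p => F p.1 p.2]).
    by move=> c _; apply/ffunP => [[x j]]; rewrite !ffunE.
  by move=> F _; apply/ffunP => x; apply/ffunP => j; rewrite !ffunE.
rewrite /W -big_mkcondr; apply: eq_big => [c | c _].
  have row_eq x : (\sum_(p | p.1 == x) c p = \sum_j curryc c x j)%N.
    by rewrite sum_fst; apply: eq_bigr => j _; rewrite !ffunE.
  have -> : (curryc c \in family (fun x (f : {ffun 'I_N -> 'I_n.+1}) =>
              (\sum_j f j)%N == a x)) = rows_a c.
    apply/familyP/forallP => rows_c x; by move: (rows_c x); rewrite unfold_in row_eq.
  (* The row sums add up to [n], which gives the condition on the total. *)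
  rewrite andb_idl // => /forallP rows_c; apply/eqP.
  rewrite -[RHS]sum_a (partition_big fst xpredT) //=; apply: eq_bigr => x _.
  exact/eqP.
rewrite mprodXE; congr 'X_[_]; apply/mnmP => j; rewrite mnmE mnm_sumE sum_snd.
by apply: eq_bigr => x _; rewrite mnmE !ffunE.
Qed.

Lemma complete0 (N : nat) : complete 0 N = 1.
Proof.
rewrite (@complete_ffun 0) // (big_pred1 [ffun=> ord0]) => [|f].
  rewrite -mpolyX0; congr 'X_[_]; apply/mnmP => j.
  by rewrite mnmE ffunE mnm0E.
rewrite sum_nat_eq0; apply/forallP/eqP => [f0 | -> j]; last by rewrite ffunE.
by apply/ffunP => j; apply/val_inj; rewrite ffunE ord1.
Qed.

(** * One-row Schur functions *)

Section Schur.
Variables n N : nat.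
Implicit Types (t : {ffun 'I_n -> 'I_N}).

Definition weakly_increasing t :=
  [forall i : 'I_n, forall j : 'I_n, (i <= j)%N ==> (t i <= t j)%N].

Let le_ord : rel 'I_N := fun a b => (a <= b)%N.

Lemma sorted_codom t : weakly_increasing t -> sorted le_ord [tuple t i | i < n].
Proof.
move=> /forallP inc_t; rewrite sorted_map.
apply: (@sub_sorted _ (relpre val leq)) => [i j le_ij | ].
  by have /forallP/(_ j)/implyP := inc_t i; apply.
by rewrite -sorted_map val_enum_ord iota_sorted.
Qed.

Lemma weakly_increasing_inj t t' : weakly_increasing t -> weakly_increasing t' ->
  content t = content t' -> t = t'.
Proof.
move=> inc_t inc_t' eq_c.
have eq_s : [tuple t i | i < n] = [tuple t' i | i < n] :> seq 'I_N.
  apply: (@sorted_eq _ le_ord); try exact: sorted_codom.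
  - by move=> ? ? ?; apply: leq_trans.
  - by move=> a b /anti_leq/val_inj.
  by apply/allP => x _ /=; rewrite !count_codom eq_c.
apply/ffunP => i; have /(congr1 (fun s => tnth s i)) := val_inj eq_s.
by rewrite !tnth_mktuple.
Qed.

Lemma weakly_increasing_onto (f : {ffun 'I_N -> 'I_n.+1}) :
  (\sum_j f j)%N = n -> exists2 t, weakly_increasing t & content t = f.
Proof.
case/content_onto=> u <-; pose s := [tuple of sort le_ord [tuple u i | i < n]].
exists [ffun i => tnth s i].
  apply/forallP => i; apply/forallP => j; apply/implyP => le_ij.
  rewrite !ffunE !(tnth_nth (u i)).
  apply: (@sorted_leq_nth _ le_ord); rewrite ?inE ?size_tuple //.
    by move=> ? ? ?; apply: leq_trans.
  by apply: sort_sorted => a b; apply: leq_total.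
apply/ffunP => x; apply/val_inj; rewrite /= -!count_codom.
rewrite (_ : [tuple _ | i < n] = s); last first.
  by apply: eq_from_tnth => i; rewrite tnth_mktuple ffunE.
by apply/seq.permP; rewrite perm_sort.
Qed.

(** Each content belongs to exactly one weakly increasing word, the sorted one. *)
Lemma sum_weakly_increasing :
  \sum_(t | weakly_increasing t) \prod_i 'X_(t i) = complete n N.
Proof.
rewrite (complete_ffun N (leqnn n)).
rewrite (partition_big (@content n _) (fun f : {ffun 'I_N -> 'I_n.+1} =>
  (\sum_j f j)%N == n)) /=; last by move=> t _; rewrite sum_content cardsE card_ord.
apply: eq_bigr => f /eqP/weakly_increasing_onto[t inc_t def_f].
rewrite (big_pred1 t) => [|t']; first by rewrite prod_word def_f.
apply/andP/eqP => [[inc_t' /eqP eq_c] | -> ]; last by rewrite def_f.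
by apply: weakly_increasing_inj; rewrite // eq_c.
Qed.

Definition row_cell (i : 'I_n) : cell [:: n] :=
  Tagged (fun r : 'I_1 => 'I_(nth 0%N [:: n] r)) (i : 'I_(nth 0%N [:: n] ord0)).

Lemma row_cell_bij : bijective row_cell.
Proof.
have lt_n (c : cell [:: n]) : (cell_col c < n)%N.
  by case: c => [[[|] // p] j]; apply: (ltn_ord j).
exists (fun c => Ordinal (lt_n c)) => [i | [[[|] // p]]]; first exact: val_inj.
(* The bound proof inside the row index is made that of [ord0], so that both dependent pairs have
   the same first component. *)
rewrite (bool_irrelevance p (ltn0Sn 0)) => j.
by congr existT; apply: val_inj.
Qed.

(** With a single row the strict column condition is vacuous, and a tableau is a weakly increasing
    word. *)
Lemma schur_row : schur [:: n] N = complete n N.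
Proof.
have [col row_cellK colK] := row_cell_bij.
rewrite -sum_weakly_increasing /schur.
pose tab t : {ffun cell [:: n] -> 'I_N} := [ffun c => t (col c)].
rewrite (reindex tab) /=; last first.
  exists (fun T : {ffun cell [:: n] -> 'I_N} => [ffun i => T (row_cell i)]) => [t|T] _.
    by apply/ffunP => i; rewrite !ffunE row_cellK.
  by apply/ffunP => c; rewrite !ffunE colK.
apply: eq_big => [t | t _]; last first.
  rewrite (reindex row_cell) /=; last by exists col => ? _.
  by apply: eq_bigr => i _; rewrite ffunE row_cellK.
apply/forallP/forallP => inc x; apply/forallP => y.
  have /forallP/(_ (row_cell y))/andP[+ _] := inc (row_cell x).
  by rewrite !ffunE !row_cellK.
rewrite -[x]colK -[y]colK !ffunE !row_cellK.
rewrite /cell_row /cell_col /= ltnn andbF /= andbT.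
by have /forallP := inc (col x); apply.
Qed.

End Schur.

(** * The partition (n) and the trivial character *)

Definition row_part (n : nat) : n.-tuple 'I_n.+1 :=
  [tuple if i == 0%N :> nat then ord_max else ord0 | i < n].

Lemma row_part_val (n : nat) :
  map val (row_part n) = if n is n'.+1 then n :: nseq n' 0%N else [::].
Proof.
case: n => [|n]; first by rewrite tuple0.
rewrite /= -map_comp enum_ordSl /= -map_comp; congr (_ :: _).
by rewrite -[in RHS](size_enum_ord n); elim: (enum _) => //= i s ->.
Qed.

Lemma is_part_row (n : nat) : is_part (row_part n).
Proof.
rewrite /is_part row_part_val; case: n => // n; apply/andP; split.
  by elim: n {1}n.+1 => //= n IHn m; rewrite IHn.
by rewrite /= sumn_nseq addn0.
Qed.

Lemma h_row (n N : nat) : h_ (map val (row_part n)) N = complete n N.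
Proof.
rewrite /h_ row_part_val; case: n => [|n]; first by rewrite big_nil complete0.
rewrite big_cons big_nseq.
by rewrite (_ : iter _ _ _ = 1) ?mulr1 //; elim: n => //= n ->; rewrite complete0 mulr1.
Qed.

(** A one-letter alphabet has a single word, fixed by every permutation; F(1) = h_n follows without
    summing over cycle types. *)
Lemma wordchar_unit (n : nat) : wordchar [ffun _ : unit => @ord_max n] = 1.
Proof.
apply/cfunP => w; rewrite wordcharE cfun1E inE (big_pred1 [ffun=> tt]) // => u.
rewrite /= (_ : u = [ffun=> tt]) ?eqxx; last by apply/ffunP => i; rewrite ffunE; case: (u i).
apply/andP; split; first by apply/fixed_wordP => i; rewrite !ffunE.
apply/eqP/ffunP => -[]; apply/val_inj; rewrite /= contentE ffunE /=.
by rewrite -[RHS]card_ord -cardsT; apply: eq_card => i; rewrite !inE.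
Qed.

Lemma Frobenius1 (n N : nat) : Frobenius (1 : 'CF([set: 'S_n])) N = complete n N.
Proof.
rewrite -wordchar_unit Frobenius_wordchar; last first.
  by rewrite (bigD1 tt) //= ffunE big1 ?addn0 // => -[].
by rewrite (bigD1 tt) //= ffunE big1 ?mulr1 // => -[].
Qed.

(** * Kronecker powers and the pairing with a one-row Schur function *)

Lemma Frobenius_invK (n : nat) (phi : 'CF([set: 'S_n])) :
  Frobenius_inv n (Frobenius phi) = phi.
Proof.
apply: Frobenius_inj; rewrite /Frobenius_inv.
by apply: (epsilon_spec _ (fun psi => forall N, Frobenius psi N = Frobenius phi N)); exists phi.
Qed.

(** The Kronecker product is the pointwise product transported by F, so F and its inverse cancel
    between successive factors. *)
Lemma kronecker_pow_Frobenius (n k : nat) (f : symfun) (phi : 'CF([set: 'S_n])) :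
  (forall N, Frobenius phi N = f N) ->
  kronecker_pow n k.+1 f = Frobenius (phi ^+ k.+1).
Proof.
move=> def_f; have {f def_f}-> : f = Frobenius phi.
  by apply: functional_extensionality_dep => N; rewrite def_f.
rewrite /kronecker_pow iteropS; elim: k => [|k IHk] //.
by rewrite iterS IHk /kronecker !Frobenius_invK -exprS.
Qed.

(** The coefficient of x^la in F(phi) is the average over [S_n] of [phi] times the permutation
    character on words of content [la]. *)
Lemma sum_mcoord_Frobenius (n : nat) (phi : 'CF([set: 'S_n]))
    (a : {ffun n.-tuple 'I_n.+1 -> algC}) :
  \sum_(la | is_part la) mcoord (Frobenius phi) la * a la =
  (n`!%:R)^-1 * \sum_(w : 'S_n) phi w *
    \sum_(la | is_part la) a la * wordchar [ffun i => tnth la i] w.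
Proof.
under eq_bigr => la _ do rewrite /mcoord mcoeff_Frobenius -mulrA mulr_suml.
rewrite -mulr_sumr exchange_big /=; congr (_ * _); apply: eq_bigr => w _.
rewrite mulr_sumr; apply: eq_bigr => la _; rewrite -mulrA; congr (_ * _).
rewrite mulrC cfunE; congr (_ * _%:R); apply: eq_card => u; rewrite !inE.
congr (_ && _); apply/eqP/eqP => [/mnmP eq_la | ->].
  by apply/ffunP => i; apply/val_inj; rewrite [in RHS]ffunE; have := eq_la i; rewrite !mnmE.
by apply/mnmP => i; rewrite !mnmE ffunE.
Qed.

Lemma Frobenius_wordchar_part (n N : nat) (la : n.-tuple 'I_n.+1) : is_part la ->
  Frobenius (wordchar [ffun i => tnth la i]) N = h_ (map val la) N.
Proof.
case/andP=> _ /eqP sum_la; rewrite Frobenius_wordchar /h_; last first.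
  rewrite -[RHS]sum_la sumnE big_map big_tuple; apply: eq_bigr => i _.
  by rewrite ffunE.
by rewrite big_map big_tuple; apply: eq_bigr => i _; rewrite ffunE.
Qed.

(* The coordinates a of s_(n) = h_n in the basis (h_la) satisfy
   \sum_la a_la M^la = 1, M^la being the permutation character on words of
   content la, because F is injective; no independence of the h_la is needed. *)
Lemma hall_Frobenius_row (n : nat) (phi : 'CF([set: 'S_n])) :
  hall n (Frobenius phi) (schur [:: n]) = (n`!%:R)^-1 * \sum_(w : 'S_n) phi w.
Proof.
rewrite /hall sum_mcoord_Frobenius; set a := hcoord _ _.
have aP N : schur [:: n] N = \sum_(la | is_part la) a la *: h_ (map val la) N.
  apply: (epsilon_spec _ (fun a : {ffun n.-tuple 'I_n.+1 -> algC} => forall N,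
    schur [:: n] N = \sum_(la | is_part la) a la *: h_ (map val la) N)) N.
  (* As s_(n) = h_n, the indicator of (n) is a valid coordinate vector; hence the vector picked by
     [epsilon], whichever it is, satisfies the expansion. *)
  exists [ffun la => (la == row_part n)%:R] => N.
  rewrite (bigD1 (row_part n)) ?is_part_row //= ffunE eqxx scale1r h_row schur_row.
  by rewrite big1 ?addr0 // => la /andP[_ /negbTE ne]; rewrite ffunE ne scale0r.
have sum_a : \sum_(la | is_part la) a la *: wordchar [ffun i => tnth la i] = 1.
  apply: Frobenius_inj => N; rewrite Frobenius1 -schur_row aP.
  rewrite (eq_bigr _ (fun la Pla => congr1 _ (esym (Frobenius_wordchar_part N Pla)))).
  rewrite /Frobenius; under [RHS]eq_bigr do rewrite scalerA mulrC -scalerA scaler_sumr.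
  rewrite -scaler_sumr exchange_big /=; congr (_ *: _); apply: eq_bigr => w _.
  rewrite sum_cfunE scaler_suml; apply: eq_bigr => la _.
  by rewrite cfunE scalerA.
congr (_ * _); apply: eq_bigr => w _.
have /cfunP/(_ w) := sum_a; rewrite sum_cfunE cfun1E inE mulr1n => sum_aw.
rewrite -[RHS]mulr1 -[in RHS]sum_aw; congr (_ * _).
by apply: eq_bigr => la _; rewrite [RHS]cfunE.
Qed.

(** * Balanced binary words and weights on the cube *)

Definition half_content (d : nat) : {ffun bool -> 'I_(2 * d).+1} := [ffun=> inord d].

Lemma halfE d b : half_content d b = d :> nat.
Proof. by rewrite ffunE inordK // ltnS mul2n -addnn leq_addr. Qed.

Lemma Frobenius_half (d N : nat) :
  Frobenius (wordchar (half_content d)) N = h_ [:: d; d] N.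
Proof.
rewrite Frobenius_wordchar big_bool !halfE; last by rewrite /= mul2n addnn.
by rewrite /h_ !big_cons big_nil mulr1.
Qed.

(** The i-th equation says that the i-th coordinate word has as many zeros as ones; its length being
    [2 * d], each occurs [d] times. *)
Lemma in_S_halves (k d : nat) (u : {ffun 'I_(2 * d) -> cube k}) :
  in_S (unbound (content u)) = [forall i, content [ffun j => u j i] == half_content d].
Proof.
apply: eq_forallb => i; set v := [ffun j => u j i].
have sum_half b : (\sum_(e : cube k | e i == b) content u e)%N = content v b.
  exact: (esym (content_map (fun e : cube k => e i) u b)).
have sum_v : (content v true + content v false)%N = (2 * d)%N.
  have := sum_content v xpredT; rewrite big_bool => ->.
  by rewrite -[RHS]card_ord -cardsT; apply: eq_card => j; rewrite !inE.
(* The factor is 1 on the face where [e i] is false and -1 on the opposite face. *)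
have -> : \sum_(e : cube k) (1 - 2 * (e i : nat)%:Z) * (unbound (content u) e)%:Z =
    (content v false)%:Z - (content v true)%:Z.
  rewrite (bigID (fun e : cube k => e i == false)) /= -!sum_half.
  rewrite -!natz !natr_sum -sumrN; congr (_ + _).
    by apply: eq_bigr => e /eqP ->; rewrite mulr0 subr0 mul1r ffunE natz.
  apply: eq_big => [e | e]; first by case: (e i).
  by rewrite eqbF_neg negbK => ->; rewrite ffunE (_ : 1 - _ = -1) // mulN1r [in RHS]natz.
rewrite subr_eq0 eqz_nat; apply/eqP/eqP => [eq_v | ->]; last by rewrite !halfE.
have [true_d false_d] : content v true = d :> nat /\ content v false = d :> nat.
  move: sum_v eq_v; move: (content v true : nat) (content v false : nat) => x y + eq_yx.
  by rewrite eq_yx mul2n addnn => /double_inj.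
by apply/ffunP => -[]; apply/val_inj; rewrite /= halfE.
Qed.

(** The k-th power counts k-tuples of balanced [w]-fixed binary words, that is, [w]-fixed words over
    the cube; Burnside counting then leaves one term per content, and these contents are the
    solutions. *)
Lemma sum_wordchar_half (d k : nat) :
  \sum_(w : 'S_(2 * d)) wordchar (half_content d) w ^+ k = ((2 * d)`!%:R) * (m_ d k)%:R.
Proof.
pose W (c : {ffun cube k -> 'I_(2 * d).+1}) : algC := (in_S (unbound c))%:R.
transitivity (\sum_(w : 'S_(2 * d))
    \sum_(u : {ffun 'I_(2 * d) -> cube k} | fixed_word w u) W (content u)).
  apply: eq_bigr => w _; rewrite wordcharE -[k in LHS]card_ord -prodr_const.
  rewrite bigA_distr_big_dep /=.
  pose swap (u : {ffun 'I_(2 * d) -> cube k}) : {ffun 'I_k -> {ffun 'I_(2 * d) -> bool}} :=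
    [ffun i => [ffun j => u j i]].
  rewrite (reindex swap) /=; last first.
    exists (fun s : {ffun 'I_k -> {ffun 'I_(2 * d) -> bool}} => [ffun j => [ffun i => s i j]]).
      by move=> u _; apply/ffunP => j; apply/ffunP => i; rewrite !ffunE.
    by move=> s _; apply/ffunP => i; apply/ffunP => j; rewrite !ffunE.
  rewrite (eq_bigl (fun u => fixed_word w u && in_S (unbound (content u)))) => [|u].
    rewrite big_mkcondr /=; apply: eq_bigr => u _; rewrite big1 //.
    by rewrite /W; case: ifP.
  rewrite in_S_halves.
  apply/familyP/andP => [fam | [/fixed_wordP fix_u /forallP half_u] i].
    split.
      apply/fixed_wordP => j; apply/ffunP => i.
      by have := fam i; rewrite unfold_in ffunE => /andP[/fixed_wordP/(_ j)]; rewrite !ffunE.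
    by apply/forallP => i; have := fam i; rewrite unfold_in ffunE => /andP[].
  rewrite unfold_in ffunE half_u andbT; apply/fixed_wordP => j.
  by rewrite !ffunE fix_u.
rewrite sum_fixed_words mulr_natl; congr (_ *+ _).
rewrite /m_ -sum1_card natr_sum [RHS](eq_bigl (fun c : {ffun cube k -> 'I_(2 * d).+1} =>
  ((\sum_x c x)%N == (2 * d)%N) && in_S (unbound c))).
  by rewrite [RHS]big_mkcondr; apply: eq_bigr => c _; rewrite /W; case: (in_S _).
move=> c; rewrite inE andbC /weight; congr ((_ == _) && _).
by apply: eq_bigr => e _; rewrite ffunE.
Qed.

Theorem theorem1p2 (k : nat) (hk : (1 <= k)%N) :
  G k =1 series_q2 (fun d : nat =>
    hall (2 * d) (kronecker_pow (2 * d) k (h_ [:: d; d])) (schur [:: (2 * d)%N])).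
Proof.
case: k hk => // k _ n; rewrite /G /series_q2; case: ifP => // _.
set d := n./2; rewrite (kronecker_pow_Frobenius k (Frobenius_half d)).
(* The pairing is now an average over the group, whose order cancels the factorial of the Burnside
   count. *)
rewrite hall_Frobenius_row; under eq_bigr do rewrite exp_cfunE ?inE //.
by rewrite sum_wordchar_half mulKf // pnatr_eq0 -lt0n fact_gt0.
Qed.
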